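(* Let $n\ge 1$ be an integer, let $\lambda,\mu>0$, let $\Gamma_a,\Gamma_s>0$ and let $\alpha\in(1,2]$. Define $$f(m) = \frac{m+1}{\mu}-\frac{m}{\lambda}+\Gamma_s (m+1)^{1/\alpha}+\Gamma_a m^{1/\alpha},$$ $$l=\left(\frac{\alpha(1/\lambda-1/\mu)}{\Gamma_a+\Gamma_s}\right)^{\alpha/(1-\alpha)}.$$ Let $\hat S_n$ be the worst-case system time of the $n$-th update in a single-source, single-server FCFS queueing system with interarrival times $\mathbf T_n\in\mathcal U_a$ and service times $\mathbf X_n\in\mathcal U_s$ (as defined in the context). Then $$\hat S_n\le \begin{cases}\max\{f(n-1),0\}, & \text{if } n-1\le \lfloor l\rfloor-1,\\ \max\{f(m^* ),0\}, & \text{otherwise,}\end{cases}$$ where $m^*\in\arg\max\{f(m): m\in\{\lfloor l\rfloor-1,\lfloor l\rfloor,\lfloor l\rfloor+1\}\cap[0,n-1]\}$.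
   Context: Updates $1,2,\dots,n$ arrive at a single-server first-come-first-served (FCFS) queue with infinite buffer. $T_i$ is the interarrival time between update $i-1$ and update $i$, and $X_i$ is the service time of update $i$; $\mathbf T_n=(T_1,\dots,T_n)$, $\mathbf X_n=(X_1,\dots,X_n)$. The system time (waiting plus service) of the $n$-th update is $$S_n=\max_{1\le k\le n}\left(\sum_{i=k}^n X_i-\sum_{i=k+1}^n T_i\right),$$ where an empty sum is $0$. The parameters $1/\mu$ and $1/\lambda$ are the mean service and interarrival times, $\alpha$ is a tail coefficient (the same for both), and $\Gamma_s,\Gamma_a$ are variability parameters. The uncertainty sets are $$\mathcal U_s=\left\{\mathbf X_n : \frac{\sum_{i=k}^n X_i-(n-k+1)/\mu}{(n-k+1)^{1/\alpha}}\le \Gamma_s\ \ \forall\,1\le k\le n\right\},$$ $$\mathcal U_a=\left\{\mathbf T_n : \frac{\sum_{i=k+1}^n T_i-(n-k)/\lambda}{(n-k)^{1/\alpha}}\ge -\Gamma_a\ \ \forall\,0\le k\le n-1\right\}.$$ The worst-case system time is $$\hat S_n=\max_{\mathbf T_n\in\mathcal U_a}\ \max_{\mathbf X_n\in\mathcal U_s}\ \max_{1\le k\le n}\left(\sum_{i=k}^n X_i-\sum_{i=k+1}^n T_i\right).$$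
   Formalization: The stability condition λ < μ is added: without it l is a power of a nonpositive number, generally undefined, and where it is defined (e.g. α = 2, λ = 2, μ = 1, Γ_a = Γ_s = 1, n = 10) the bound fails. *)

(* Defs.v *)
From HB Require Import structures.
From mathcomp Require Import all_boot all_order all_algebra.
From mathcomp Require Import all_classical all_reals all_analysis.

Set Implicit Arguments.
Unset Strict Implicit.
Unset Printing Implicit Defensive.

Import Order.TTheory GRing.Theory Num.Theory.

Local Open Scope classical_set_scope.
Local Open Scope ring_scope.

(* Coordinate i : 'I_n of a vector of interarrival or service times belongs to
   update i + 1.  The tail sum \sum_(i < n | k <= i) thus runs over the n - k
   updates k + 1, ..., n. *)

(* k : 'I_n is update k + 1, so the sum of T starts at update k + 2.  The
   neutral element -oo is never the value when 0 < n. *)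
Definition system_time (R : realType) (n : nat) (T X : 'rV[R]_n) : \bar R :=
  \big[maxe/-oo%E]_(k < n)
    (\sum_(i < n | (k <= i)%N) X ord0 i
     - \sum_(i < n | (k < i)%N) T ord0 i)%:E.

(* Components are arbitrary reals: nonnegativity is not imposed. *)
Definition service_uncertainty_set (R : realType) (n : nat)
    (mu alpha Gs : R) : set 'rV[R]_n :=
  [set X | forall k : 'I_n,
     (\sum_(i < n | (k <= i)%N) X ord0 i - (n - k)%:R / mu)
       / (n - k)%:R `^ (1 / alpha) <= Gs].

Definition arrival_uncertainty_set (R : realType) (n : nat)
    (lam alpha Ga : R) : set 'rV[R]_n :=
  [set T | forall k : 'I_n,
     (\sum_(i < n | (k <= i)%N) T ord0 i - (n - k)%:R / lam)
       / (n - k)%:R `^ (1 / alpha) >= - Ga].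

(* Suprema in \bar R, so that unbounded or unattained values are not hidden by
   a default value. *)
Definition worst_case_system_time (R : realType) (n : nat)
    (lam mu alpha Ga Gs : R) : \bar R :=
  ereal_sup [set ereal_sup [set system_time T X
                           | X in @service_uncertainty_set R n mu alpha Gs]
            | T in @arrival_uncertainty_set R n lam alpha Ga].

Definition tail_bound (R : realType) (lam mu alpha Ga Gs : R) (m : nat) : R :=
  (m + 1)%:R / mu - m%:R / lam
  + Gs * (m + 1)%:R `^ (1 / alpha) + Ga * m%:R `^ (1 / alpha).

(* The base is positive exactly when lam < mu; outside that range powR returns
   a default value that has no meaning here. *)
Definition critical_length (R : realType) (lam mu alpha Ga Gs : R) : R :=
  (alpha * (1 / lam - 1 / mu) / (Ga + Gs)) `^ (alpha / (1 - alpha)).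

(* Integers, since floor l - 1 may be -1; being of type nat, m is in
   [0, n - 1] as soon as m <= n - 1. *)
Definition candidates (R : realType) (n : nat) (l : R) : set nat :=
  [set m : nat | m%:Z \in [:: Num.floor l - 1; Num.floor l; Num.floor l + 1]
                 /\ (m <= n - 1)%N].

Definition argmax (I : Type) (R : realType) (A : set I) (f : I -> R) : set I :=
  [set m | A m /\ forall m', A m' -> f m' <= f m].

(* Main.v *)
Require Import Defs.
From HB Require Import structures.
From mathcomp Require Import all_boot all_order all_algebra.
From mathcomp Require Import all_classical all_reals all_analysis.
From mathcomp Require Import zify ring lra.

Import Order.TTheory GRing.Theory Num.Theory.

Local Open Scope classical_set_scope.
Local Open Scope ring_scope.

(* Bounding both tail sums through the uncertainty sets bounds the system time
   by the largest f m with 0 <= m <= n - 1.  Since x `^ (1 / alpha) is concave,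
   its unit increments compare with the tangent slope at l, and l is the point
   where (Gs + Ga) / alpha * l `^ (1 / alpha - 1) equals 1 / lam - 1 / mu; hence
   f increases up to floor l - 1 and decreases from floor l + 1 on. *)

(** Young's inequality with exponents [p^-1] and [(1 - p)^-1], applied to [y ^ p] and [x ^ (1 - p)],
    bounds their product by [p * y + (1 - p) * x]; multiplying by [x ^ (p - 1)] gives the tangent
    line at [x]. *)
Lemma powR_le_tangent (R : realType) (p x y : R) :
  0 < p -> p < 1 -> 0 < x -> 0 <= y ->
  y `^ p <= x `^ p + p * x `^ (p - 1) * (y - x).
Proof.
move=> p0 p1 x0 y0.
have q0 : 0 < 1 - p by lra.
have := @conjugate_powR R (y `^ p) (x `^ (1 - p)) p^-1 (1 - p)^-1.
rewrite !powR_ge0 !invr_gt0 p0 q0 !invrK -!powRrM !divff ?gt_eqF//.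
rewrite !powRr1 ?(ltW x0)// subrKC => /(_ isT isT isT isT erefl) young.
have xx : x `^ (p - 1) * x = x `^ p by rewrite mulrC mulr_powRB1 // ltW.
have xV : x `^ (p - 1) * x `^ (1 - p) = 1.
  by rewrite -(opprB 1 p) powRN mulVf // gt_eqF // powR_gt0.
have := ler_wpM2l (powR_ge0 x (p - 1)) young.
have -> : x `^ (p - 1) * (y `^ p * x `^ (1 - p)) = y `^ p.
  by rewrite mulrCA xV mulr1.
by rewrite mulrDr -xx; nra.
Qed.

Lemma le0_powR_antitone (R : realType) (r x y : R) :
  r <= 0 -> 0 < x -> x <= y -> y `^ r <= x `^ r.
Proof.
move=> r0 x0 xy; have y0 := lt_le_trans x0 xy.
rewrite -(opprK r) !(powRN _ (- r)) lef_pV2 ?posrE ?powR_gt0//.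
by apply: ge0_ler_powR; rewrite ?nnegrE ?oppr_ge0 ?(ltW x0) ?(ltW y0).
Qed.

Lemma powR_increment_le (R : realType) (p x y : R) :
  0 < p -> p < 1 -> 0 < x -> x <= y ->
  (y + 1) `^ p - y `^ p <= p * x `^ (p - 1).
Proof.
move=> p0 p1 x0 xy; have y0 := lt_le_trans x0 xy.
have := powR_le_tangent R p y (y + 1) p0 p1 y0.
rewrite addrAC subrr add0r mulr1 addr_ge0 ?(ltW y0)// => /(_ isT) tan.
have anti : y `^ (p - 1) <= x `^ (p - 1).
  by apply: le0_powR_antitone => //; lra.
by have := ler_wpM2l (ltW p0) anti; lra.
Qed.

(** The tangent is taken at the right end [y + 1], so that [y = 0], where the slope is infinite, is
    covered. *)
Lemma powR_increment_ge (R : realType) (p x y : R) :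
  0 < p -> p < 1 -> 0 <= y -> y + 1 <= x ->
  p * x `^ (p - 1) <= (y + 1) `^ p - y `^ p.
Proof.
move=> p0 p1 y0 yx; have y1 : 0 < y + 1 by lra.
have := powR_le_tangent R p (y + 1) y p0 p1 y1 y0.
have -> : y - (y + 1) = -1 by ring.
have anti : x `^ (p - 1) <= (y + 1) `^ (p - 1).
  by apply: le0_powR_antitone => //; lra.
by have := ler_wpM2l (ltW p0) anti; lra.
Qed.

Section Bound.
Variables (R : realType) (lam mu Ga Gs alpha : R).
Hypotheses (hlam : 0 < lam) (hmu : 0 < mu) (hGa : 0 < Ga) (hGs : 0 < Gs).
Hypotheses (halpha1 : 1 < alpha) (hlammu : lam < mu).

Let f := tail_bound lam mu alpha Ga Gs.
Let l := critical_length lam mu alpha Ga Gs.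

Lemma inv_alpha_itv : (0 < 1 / alpha) /\ (1 / alpha < 1).
Proof.
have a0 : 0 < alpha := lt_trans ltr01 halpha1.
by rewrite div1r invr_gt0 invf_lt1.
Qed.

(** This is where [lam < mu] enters: it keeps [powR] off its default values, so that [l] is a
    genuine power. *)
Lemma critical_base_gt0 : 0 < alpha * (1 / lam - 1 / mu) / (Ga + Gs).
Proof.
have a0 : 0 < alpha := lt_trans ltr01 halpha1.
by rewrite divr_gt0 ?addr_gt0 // mulr_gt0 // subr_gt0 !div1r ltf_pV2.
Qed.

Lemma critical_length_gt0 : 0 < l.
Proof. exact: powR_gt0 critical_base_gt0. Qed.

Lemma critical_slope :
  (Gs + Ga) * (1 / alpha * l `^ (1 / alpha - 1)) = 1 / lam - 1 / mu.
Proof.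
rewrite /l /critical_length -powRrM.
(* The two exponents are reciprocal, so the power of [l] collapses to the base. *)
have -> : alpha / (1 - alpha) * (1 / alpha - 1) = 1.
  by field; move: halpha1 => a1; apply/andP; split; lra.
rewrite powRr1 ?(ltW critical_base_gt0)//.
by field; move: halpha1 hlam hmu hGa hGs => *; rewrite !gt_eqF //; lra.
Qed.

(** The service increment runs one step ahead of the arrival increment. Hence ascent needs
    [m + 2 <= l], to have both to the left of [l], while descent needs only [l <= m]. *)
Lemma tail_boundS m : f m.+1 - f m =
  Gs * ((m.+1%:R + 1) `^ (1 / alpha) - m.+1%:R `^ (1 / alpha))
  + Ga * ((m%:R + 1) `^ (1 / alpha) - m%:R `^ (1 / alpha))
  - (1 / lam - 1 / mu).
Proof. by rewrite /f /tail_bound !addn1 -!natr1; lra. Qed.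

Lemma tail_bound_ascent m : m.+2%:R <= l -> f m <= f m.+1.
Proof.
move=> ml; have [p0 p1] := inv_alpha_itv.
rewrite -subr_ge0 tail_boundS -critical_slope.
have m2l : m.+1%:R + 1 <= l by rewrite natr1.
have m1l : m%:R + 1 <= l by rewrite natr1 (le_trans _ ml) // ler_nat.
have := ler_wpM2l (ltW hGs) (powR_increment_ge _ _ _ _ p0 p1 (ler0n _ m.+1) m2l).
have := ler_wpM2l (ltW hGa) (powR_increment_ge _ _ _ _ p0 p1 (ler0n _ m) m1l).
by lra.
Qed.

Lemma tail_bound_descent m : l <= m%:R -> f m.+1 <= f m.
Proof.
move=> lm; have [p0 p1] := inv_alpha_itv.
rewrite -subr_le0 tail_boundS -critical_slope.
have lm1 : l <= m.+1%:R by rewrite (le_trans lm) // ler_nat.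
have := ler_wpM2l (ltW hGa) (powR_increment_le _ _ _ _ p0 p1 critical_length_gt0 lm).
have := ler_wpM2l (ltW hGs) (powR_increment_le _ _ _ _ p0 p1 critical_length_gt0 lm1).
by lra.
Qed.

Lemma tail_bound_nondecreasing i j : (i <= j)%N -> j.+1%:R <= l -> f i <= f j.
Proof.
move=> /subnK <-; elim: (j - i)%N => [|d IH] // dl.
rewrite addSn; apply: le_trans (IH _) (tail_bound_ascent _ _) => //.
by apply: le_trans dl; rewrite ler_nat addSn ltnW.
Qed.

Lemma tail_bound_nonincreasing i j : (i <= j)%N -> l <= i%:R -> f j <= f i.
Proof.
move=> /subnK <-; elim: (j - i)%N => [|d IH] // li.
rewrite addSn; apply: le_trans (tail_bound_descent _ _) (IH _) => //.
by apply: le_trans li _; rewrite ler_nat leq_addl.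
Qed.

Lemma system_time_term_le n (T X : 'rV[R]_n) (k : 'I_n) :
  arrival_uncertainty_set lam alpha Ga T ->
  service_uncertainty_set mu alpha Gs X ->
  \sum_(i < n | (k <= i)%N) X ord0 i - \sum_(i < n | (k < i)%N) T ord0 i
    <= f (n - k.+1)%N.
Proof.
move=> arrT srvX.
have nk : (n - k.+1 + 1 = n - k)%N by rewrite addn1 subnSK.
have := srvX k; rewrite ler_pdivrMr; last first.
  by rewrite powR_gt0 // ltr0n subn_gt0.
rewrite /f /tail_bound nk => srv.
have arr : (n - k.+1)%:R / lam - Ga * (n - k.+1)%:R `^ (1 / alpha)
           <= \sum_(i < n | (k < i)%N) T ord0 i.
  (* The sum of [T] starts one index after [k], so the arrival constraint at [k + 1] is the one to
     use. For the last update there is none: the sum is empty, and the bound vanishes since [0] to a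
     nonzero power is [0]. *)
  have [kn|] := ltnP k.+1 n; last first.
    move=> nk1; rewrite (eqP nk1) big_pred0 => [|i]; last first.
      by apply/negbTE; rewrite -leqNgt -ltnS (leq_trans (ltn_ord i)).
    have [p0 _] := inv_alpha_itv.
    by rewrite powR0 ?gt_eqF // mul0r mulr0 subrr.
  have := arrT (Ordinal kn); rewrite ler_pdivlMr /=; first by lra.
  by rewrite powR_gt0 // ltr0n subn_gt0.
lra.
Qed.

Lemma worst_case_system_time_le n (M : R) :
  (forall m, (m < n)%N -> f m <= M) ->
  (worst_case_system_time n lam mu alpha Ga Gs <= M%:E)%E.
Proof.
move=> fM; apply: ge_ereal_sup => _ [T arrT <-].
apply: ge_ereal_sup => _ [X srvX <-].
apply: bigmax_le => [|k _]; first exact: leNye.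
rewrite lee_fin; apply: le_trans (system_time_term_le _ _ _ _ arrT srvX) (fM _ _).
by have := ltn_ord k; lia.
Qed.

End Bound.

Theorem theorem1 (R : realType) (n : nat) (lam mu Ga Gs alpha : R)
    (hn : (1 <= n)%N) (hlam : 0 < lam) (hmu : 0 < mu)
    (hGa : 0 < Ga) (hGs : 0 < Gs) (halpha1 : 1 < alpha) (halpha2 : alpha <= 2)
    (hlammu : lam < mu) :
  let f := tail_bound lam mu alpha Ga Gs in
  let l := critical_length lam mu alpha Ga Gs in
  let Shat := worst_case_system_time n lam mu alpha Ga Gs in
  ((n - 1)%N%:Z <= Num.floor l - 1 ->
     (Shat <= (Num.max (f (n - 1)%N) 0)%:E)%E) /\
  (~ ((n - 1)%N%:Z <= Num.floor l - 1) ->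
     forall mstar : nat, argmax (candidates n l) f mstar ->
       (Shat <= (Num.max (f mstar) 0)%:E)%E).
Proof.
move=> f l Shat.
have l0 : 0 < l by exact: critical_length_gt0.
(* As [l] is positive, its floor is a natural number, possibly [0]. *)
have [K floorK] : exists K : nat, Num.floor l = K%:Z.
  by exists `|Num.floor l|%N; rewrite gez0_abs // floor_ge0 ltW.
have /andP[Kl lK] := floor_itv l.
rewrite floorK -pmulrn in Kl; rewrite floorK intrD -pmulrn natr1 in lK.
have incr i j : (i <= j)%N -> (j < K)%N -> f i <= f j.
  move=> ij jK; apply: tail_bound_nondecreasing => //.
  by apply: le_trans Kl; rewrite ler_nat.
have decr j : (K < j)%N -> f j <= f K.+1.
  by move=> Kj; apply: tail_bound_nonincreasing => //; exact: ltW.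
rewrite floorK; split => [nK | nK m [_ fm]].
  apply: worst_case_system_time_le => // i ni.
  by rewrite le_max incr //; lia.
apply: worst_case_system_time_le => // i ni.
rewrite le_max; apply/orP; left.
have cand j : (K <= j.+1)%N -> (j <= K.+1)%N -> (j < n)%N -> f j <= f m.
  move=> Kj jK jn; apply: fm; split; last by lia.
  by rewrite floorK !inE; lia.
(* If [i < K], then [K] is positive and [f i] is at most [f] at the candidate [K - 1], which lies
   below [n] because [K <= n - 1] in this branch. *)
have [iK | Ki] := ltnP i K.
  by apply: le_trans (incr i K.-1 _ _) (cand _ _ _ _); lia.
(* Beyond [K + 1], [f i] is at most [f] at the candidate [K + 1], admissible because it is less than
   [i]; otherwise [i] is itself [K] or [K + 1]. *)
have [Ki' | iK] := ltnP K.+1 i.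
  by apply: le_trans (decr _ _) (cand _ _ _ _); lia.
by apply: cand => //; lia.
Qed.
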